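(* Let $G_{1}$ and $G_{2}$ be two finite groups and let $G=G_{1}\times G_{2}$. Then $\delta(G)=\delta_{irr}(G_{1})+\delta_{irr}(G_{2})$ in each of the following cases: (1) $G_1$ and $G_2$ are noncyclic simple groups; (2) $G_1$ and $G_2$ are noncyclic groups of prime power order, for distinct primes, and each has cyclic center; (3) $G_1$ and $G_2$ are nonabelian monolithic groups.
   Context: Representations are over $\mathbb{C}$. For a finite group $H$, $\delta(H)$ is the minimal degree of a faithful complex representation of $H$, and $\delta_{irr}(H)$ is the minimal degree of a faithful irreducible complex representation of $H$, when one exists. A group is monolithic if it has a unique minimal normal subgroup that is contained in every nontrivial normal subgroup. *)

(* Defs.v *)
From mathcomp Require Import all_boot all_order all_fingroup all_solvable.
From mathcomp Require Import all_algebra all_field all_character.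
From mathcomp Require Import boolp reals complex.

Set Implicit Arguments.
Unset Strict Implicit.
Unset Printing Implicit Defensive.

Section FaithfulDegrees.

Variables (F : fieldType) (gT : finGroupType) (G : {group gT}).

Definition faithful_degree (n : nat) : Prop :=
  exists rG : mx_representation F G n, mx_faithful rG.

(* [mx_irreducible] requires a nonzero module, so such an [n] is positive. *)
Definition faithful_irr_degree (n : nat) : Prop :=
  exists rG : mx_representation F G n, mx_faithful rG /\ mx_irreducible rG.

Lemma ex_faithful_degree : exists n, `[< faithful_degree n >].
Proof.
exists #|G|; apply/asboolP; exists (regular_repr F G).
exact: regular_mx_faithful.
Qed.

Definition delta : nat := ex_minn ex_faithful_degree.

Definition has_faithful_irr : Prop := exists n, `[< faithful_irr_degree n >].

(* The value 0 is a placeholder for groups with no faithful irreducible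
   representation; it is never the degree of an irreducible representation. *)
Definition delta_irr : nat :=
  if pselect has_faithful_irr is left ex_irr then ex_minn ex_irr else 0.

Lemma deltaP :
  faithful_degree delta /\ (forall n, faithful_degree n -> delta <= n).
Proof.
rewrite /delta; case: ex_minnP => m /asboolP fm minm.
by split=> // n /asboolP /minm.
Qed.

Lemma delta_irrP : has_faithful_irr ->
  faithful_irr_degree delta_irr /\
  (forall n, faithful_irr_degree n -> delta_irr <= n).
Proof.
rewrite /delta_irr; case: pselect => // ex_irr _.
case: ex_minnP => m /asboolP fm minm.
by split=> // n /asboolP /minm.
Qed.

End FaithfulDegrees.

Arguments delta F {gT} G.
Arguments delta_irr F {gT} G.
Arguments has_faithful_irr F {gT} G.

(* [minnormal N G] does not by itself require [N] to be contained in [G]. *)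
Definition min_normal_subgroup (gT : finGroupType) (N G : {group gT}) : bool :=
  (N \subset G) && minnormal N G.

Definition monolithic (gT : finGroupType) (G : {group gT}) : Prop :=
  exists N : {group gT},
    [/\ min_normal_subgroup N G,
        forall M : {group gT}, min_normal_subgroup M G -> M = N
      & forall M : {group gT}, (M <| G)%g -> M :!=: 1%g -> N \subset M].

(* Main.v *)
Require Import Defs.
From mathcomp Require Import all_boot all_order all_fingroup all_solvable.
From mathcomp Require Import all_algebra all_field all_character.
From mathcomp Require Import boolp reals complex.

Set Implicit Arguments.
Unset Strict Implicit.
Unset Printing Implicit Defensive.

Import GroupScope GRing.Theory Num.Theory.
Local Open Scope ring_scope.

(** The product formula is a statement about two nonabelian groups [G1], [G2]
    each with a monolith: a nontrivial normal subgroup [N1], [N2] contained in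
    every nontrivial normal subgroup.  A noncyclic simple group is such a
    group, with itself as monolith, and so is a noncyclic p-group with cyclic
    center [Z], whose monolith is the subgroup of order p of [Z]; hence the
    three cases are one ([delta_product_monolith]).

    The use of a monolith [N] is that a module on which [N] acts nontrivially
    is faithful, because the kernel is normal and does not contain [N]
    ([monolith_rstab1]).  Applied to a simple constituent of the regular
    representation, this gives a faithful irreducible representation; and the
    sum of two such, of [G1] and of [G2], is faithful on [G1 x G2], so delta
    is at most the sum of the two irreducible degrees ([delta_product_le]).

    Conversely, split a faithful module of [G1 x G2] into simple summands.
    Some summand [M] is not fixed by [N1], and some summand [M'] is not fixed
    by [N2].  By Maschke's theorem for [G1], [M] contains a faithful simple
    [G1]-module [U1], and likewise [M'] contains a faithful simple [G2]-module
    [U2].  If [M] and [M'] are different summands their dimensions add up and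
    the bound is clear.  If [M = M'], it is enough to know that both
    [2 dim U1] and [2 dim U2] are at most [dim M] ([commuting_double_rank]),
    which spares the factorization of [M] as a tensor product.  Indeed, since
    [G2] commutes with [G1], the translates of [U1] by [G2] are simple
    [G1]-modules.  If all of them equal [U1], then [U1 = M] by simplicity of
    [M], so [G2] acts on [M] by scalars by Schur's lemma, and being faithful
    on [U2] it is abelian ([commuting_simple_abelian]), which is excluded.
    Otherwise [U1] meets some translate in 0, and their sum, of dimension
    [2 dim U1], lies in [M].  The roles of [G1] and [G2] are symmetric. *)

(** * Monoliths *)

Definition monolith (gT : finGroupType) (N G : {group gT}) : Prop :=
  [/\ N <| G, N :!=: 1%g
    & forall M : {group gT}, M <| G -> M :!=: 1%g -> N \subset M].

Lemma monolithic_monolith (gT : finGroupType) (G : {group gT}) :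
  monolithic G -> exists N, monolith N G.
Proof.
case=> N [/andP[sNG /mingroupP[/andP[ntN nNG] _]] _ minN].
by exists N; split; rewrite // /normal sNG.
Qed.

Lemma simple_monolith (gT : finGroupType) (G : {group gT}) :
  simple G -> monolith G G.
Proof.
by case/simpleP=> ntG simG; split=> // M /simG[-> /eqP|->].
Qed.

(** In an abelian group every cyclic subgroup is normal, so a simple one is
    generated by any of its nontrivial elements. *)
Lemma simple_noncyclic_nonabelian (gT : finGroupType) (G : {group gT}) :
  simple G -> ~~ cyclic G -> ~~ abelian G.
Proof.
case/simpleP=> /trivgPn[x Gx ntx] simG; apply: contra => cGG.
have nsxG: <[x]>%G <| G by rewrite -sub_abelian_normal ?cycle_subG.
case: (simG _ nsxG) => /= [/eqP|<-]; last exact: cycle_cyclic.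
by rewrite cycle_eq1 (negPf ntx).
Qed.

(** In a nilpotent group a nontrivial normal subgroup meets the center
    nontrivially, and a nontrivial subgroup of a cyclic p-group contains the
    only subgroup of order p. *)
Lemma pgroup_cyclic_center_monolith (gT : finGroupType) (G : {group gT})
    (p : nat) :
    p.-group G -> G :!=: 1%g -> cyclic 'Z(G) ->
  monolith 'Ohm_1('Z(G))%G G.
Proof.
move=> pG ntG cycZ; have nilG := pgroup_nil pG.
have pZ: p.-group 'Z(G) := pgroupS (center_sub G) pG.
split=> [||M nsMG ntM].
- exact: gFnormal_trans (center_normal G).
- by rewrite /= Ohm1_eq1 center_nil_eq1.
have ntMZ := meet_center_nil nilG nsMG ntM.
have cycMZ: cyclic (M :&: 'Z(G)) := cyclicS (subsetIr _ _) cycZ.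
have pMZ: p.-group (M :&: 'Z(G)) := pgroupS (subsetIr _ _) pZ.
suffices /= <-: 'Ohm_1(M :&: 'Z(G)) = 'Ohm_1('Z(G)).
  exact: subset_trans (Ohm_sub 1 _) (subsetIl _ _).
apply/eqP; rewrite eqEcard OhmS ?subsetIr //=.
rewrite (Ohm1_cyclic_pgroup_prime cycMZ pMZ ntMZ).
by rewrite (Ohm1_cyclic_pgroup_prime cycZ pZ) // center_nil_eq1.
Qed.

Lemma pgroup_cyclic_center_nonabelian (gT : finGroupType) (G : {group gT}) :
  cyclic 'Z(G) -> ~~ cyclic G -> ~~ abelian G.
Proof. by move=> cycZ; apply: contra => /center_idP <-. Qed.

(** * Faithful simple constituents *)

Section Constituents.

Variables (F : numClosedFieldType) (gT : finGroupType) (G : {group gT}).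
Variables (n : nat) (rG : mx_representation F G n).
Implicit Types (U V : 'M[F]_n) (N : {group gT}).

(** Maschke's theorem; the decomposition is data and exists only classically,
    whence [inhabited]. *)
Lemma num_mxmodule_semisimple U :
  mxmodule rG U -> inhabited (mxsemisimple rG U).
Proof.
move=> modU; apply/asboolP.
have F'G: [pchar F]^'.-group G.
  by apply/pgroupP=> p _ _; rewrite inE /= pchar_num.
have := mx_reducible_semisimple (mxmodule1 rG) (mx_Maschke_pchar rG F'G).
apply=> ssim1; apply/asboolP; constructor.
exact: mxsemisimpleS modU (submx1 U) ssim1.
Qed.

Lemma exists_not_rstab_sum (I : finType) (W : I -> 'M[F]_n) N U :
    N \subset G -> (U <= \sum_i W i)%MS -> ~~ (N \subset rstab rG U) ->
  exists i, ~~ (N \subset rstab rG (W i)).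
Proof.
move=> sNG sUW; rewrite rfix_mx_rstabC // => notfix.
apply/existsP; apply: contraR notfix => /existsPn fixW.
apply: submx_trans sUW _; apply/sumsmx_subP=> i _.
by have /negPn := fixW i; rewrite rfix_mx_rstabC.
Qed.

Lemma exists_simple_not_rstab N U :
    N \subset G -> mxmodule rG U -> ~~ (N \subset rstab rG U) ->
  exists W, [/\ mxsimple rG W, (W <= U)%MS & ~~ (N \subset rstab rG W)].
Proof.
move=> sNG /num_mxmodule_semisimple[[I W /= simW defU _]] notfix.
have [|i notfix_i] := exists_not_rstab_sum (W := W) sNG _ notfix.
  by rewrite defU.
by exists (W i); split; rewrite // -defU (sumsmx_sup i).
Qed.

Lemma notsub_rstab_faithful N :
  monolith N G -> mx_faithful rG -> ~~ (N \subset rstab rG 1%:M).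
Proof.
case=> _ ntN _ faithG; apply: contra ntN => sNK.
by rewrite -subG1 (subset_trans sNK).
Qed.

(** The elements acting trivially on a module form a normal subgroup, and a
    nontrivial one would contain the monolith. *)
Lemma monolith_rstab1 N U :
    monolith N G -> mxmodule rG U -> ~~ (N \subset rstab rG U) ->
  rstab rG U = 1%g.
Proof.
move=> [_ _ minN] modU; apply: contraNeq => nt.
by apply: (minN (rstab_group rG U)); first exact: rstab_normal.
Qed.

Lemma simple_faithful_irr_degree U :
  mxsimple rG U -> rstab rG U = 1%g -> faithful_irr_degree F G (\rank U).
Proof.
move=> simU stU1; have modU := mxsimple_module simU.
exists (submod_repr modU); split; last exact/submod_mx_irr.
by rewrite /mx_faithful rker_submod stU1.
Qed.

Lemma exists_faithful_simple N U :
    monolith N G -> mxmodule rG U -> ~~ (N \subset rstab rG U) ->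
  exists W, [/\ mxsimple rG W, (W <= U)%MS & rstab rG W = 1%g].
Proof.
move=> monoN modU notfix; have [/normal_sub sNG _ _] := monoN.
have [W [simW sWU ntW]] := exists_simple_not_rstab sNG modU notfix.
exists W; split=> //.
exact: monolith_rstab1 monoN (mxsimple_module simW) ntW.
Qed.

(** Schur's lemma for a submodule: an eigenspace of [g] meeting [U]
    nontrivially is a submodule, hence contains [U]. *)
Lemma mxsimple_commutant_scalar U g :
    mxsimple rG U -> centgmx rG g -> (U *m g <= U)%MS ->
  exists a, U *m g = a *: U.
Proof.
move=> [modU ntU minU] cGg Ug.
(* [A] is the matrix of the restriction of [g] to [U] in the basis [B]. *)
pose B := row_base U; pose A := B *m g *m pinvmx B.
have BgE: A *m B = B *m g.
  by rewrite mulmxKpV // (eqmxMr _ (eq_row_base U)) eq_row_base.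
have r_gt0: (0 < \rank U)%N by rewrite lt0n mxrank_eq0.
have [a] := eigenvalue_closed A r_gt0.
case/eigenvalueP=> v vA ntv; exists a.
pose K := kermx (g - a%:M).
have modK: mxmodule rG K.
  apply: kermx_centg_module; apply/centgmxP=> x Gx.
  by rewrite mulmxBl mulmxBr (centgmxP cGg) // scalar_mxC.
have sUK: (U <= K)%MS.
  suffices: (U <= U :&: K)%MS by rewrite sub_capmx submx_refl.
  apply: minU; rewrite ?capmx_module ?capmxSl //.
  have ntvB: v *m B != 0.
    by rewrite -(mul0mx _ B) (inj_eq (row_free_inj (row_base_free U))).
  apply: contraNneq ntvB => K0; rewrite -submx0 -K0 sub_capmx.
  rewrite (submx_trans (submxMl v B)) ?eq_row_base //=.
  apply/sub_kermxP; rewrite mulmxBr mul_mx_scalar -mulmxA -BgE mulmxA vA.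
  by rewrite scalemxAl subrr.
apply/eqP; rewrite -subr_eq0 -mul_mx_scalar -mulmxBr.
exact/eqP/sub_kermxP.
Qed.

End Constituents.

Lemma delta_irr_min (F : fieldType) (gT : finGroupType) (G : {group gT}) n :
  faithful_irr_degree F G n -> (delta_irr F G <= n)%N.
Proof.
move=> fn; suffices /delta_irrP[_]: has_faithful_irr F G by apply.
by exists n; apply/asboolP.
Qed.

Lemma monolith_has_faithful_irr (F : numClosedFieldType) (gT : finGroupType)
    (N G : {group gT}) :
  monolith N G -> has_faithful_irr F G.
Proof.
move=> monoN; pose rG := regular_repr F G.
have ntN := notsub_rstab_faithful monoN (regular_mx_faithful F G).
have [W [simW _ stW1]] := exists_faithful_simple monoN (mxmodule1 rG) ntN.
by exists (\rank W); apply/asboolP; apply: simple_faithful_irr_degree simW stW1.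
Qed.

(** * Two commuting groups acting on one space *)

Section CommutingRepresentations.

Variables (F : numClosedFieldType) (gT1 gT2 : finGroupType).
Variables (G1 : {group gT1}) (G2 : {group gT2}) (n : nat).
Variables (r1 : mx_representation F G1 n) (r2 : mx_representation F G2 n).
Hypothesis cr12 : forall x y, x \in G1 -> y \in G2 ->
  r1 x *m r2 y = r2 y *m r1 x.
Implicit Types U M : 'M[F]_n.

Let cent2 y : y \in G2 -> centgmx r1 (r2 y).
Proof. by move=> G2y; apply/centgmxP=> x G1x; rewrite cr12. Qed.

(** By Schur's lemma [G2] acts on [M] by scalars, so all commutators of [G2]
    act trivially on [U]. *)
Lemma commuting_simple_abelian M U :
    mxsimple r1 M -> mxmodule r2 M -> (U <= M)%MS -> rstab r2 U = 1%g ->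
  abelian G2.
Proof.
move=> simM modM sUM stU1.
have scal y: y \in G2 -> exists a, U *m r2 y = a *: U.
  move=> G2y; have [|a Ma] := mxsimple_commutant_scalar simM (cent2 G2y).
    exact: (mxmoduleP modM).
  exists a; have /submxP[D ->] := sUM.
  by rewrite -mulmxA Ma scalemxAr.
apply/centsP=> x G2x y G2y.
have [[a Ux] [b Uy]] := (scal x G2x, scal y G2y).
have Uxy: U *m r2 (x * y)%g = U *m r2 (y * x)%g.
  by rewrite !repr_mxM // !mulmxA Ux Uy -!scalemxAl Ux Uy !scalerA mulrC.
have: (x * y * (y * x)^-1)%g \in rstab r2 U.
  rewrite inE groupM ?groupV ?groupM //= repr_mxM ?groupV ?groupM // mulmxA.
  by rewrite Uxy -mulmxA -repr_mxM ?groupV ?groupM // mulgV repr_mx1 mulmx1.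
by rewrite stU1 => /set1gP/eqP; rewrite -eq_mulgV1 => /eqP.
Qed.

(** Here [M] is simple for the joint action of both groups.  The submodule
    [U'] is only there to rule out that [G2] acts on [M] by scalars; then some
    element of [G2] moves [U] to a different simple [G1]-module inside [M]. *)
Lemma commuting_double_rank M U U' :
    ~~ abelian G2 -> mxmodule r2 M ->
    (forall W : 'M_n, mxmodule r1 W -> mxmodule r2 W -> (W <= M)%MS ->
       W != 0 -> (M <= W)%MS) ->
    mxsimple r1 U -> (U <= M)%MS ->
    (U' <= M)%MS -> rstab r2 U' = 1%g ->
  (2 * \rank U <= \rank M)%N.
Proof.
move=> nab2 modM minM simU sUM sU'M stU'1; have [modU ntU minU] := simU.
(* Otherwise [U] = [M] would be simple for [G1] alone. *)
have ltUM: ~~ (M <= U)%MS.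
  apply: contra nab2 => sMU; have eqUM: (U :=: M)%MS by apply/eqmxP/andP.
  apply: (commuting_simple_abelian simU _ (submx_trans sU'M sMU) stU'1).
  by rewrite (eqmx_module _ eqUM).
have [y G2y notUy]: exists2 y, y \in G2 & ~~ (U *m r2 y <= U)%MS.
  apply: contrapT => allU; case/negP: ltUM; apply: minM => //.
  apply/mxmoduleP=> y G2y; apply: contrapT => /negP notUy.
  by apply: allU; exists y.
have G2V: (y^-1)%g \in G2 by rewrite groupV.
have modUy: mxmodule r1 (U *m r2 y).
  apply/mxmoduleP=> x G1x; rewrite -mulmxA -cr12 // mulmxA submxMr //.
  exact: (mxmoduleP modU).
have UyM: (U *m r2 y <= M)%MS.
  exact: submx_trans (submxMr _ sUM) (mxmoduleP modM y G2y).
have rUy: \rank (U *m r2 y) = \rank U by rewrite mxrankMfree ?repr_mx_free.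
have I0: (U :&: U *m r2 y)%MS = 0.
  apply/eqP; apply: contraNT notUy => ntI.
  have sUI: (U <= U :&: U *m r2 y)%MS.
    by apply: minU; rewrite ?capmx_module ?capmxSl.
  have sUUy: (U <= U *m r2 y)%MS := submx_trans sUI (capmxSr _ _).
  by rewrite -(geq_leqif (mxrank_leqif_sup sUUy)) rUy.
rewrite mul2n -addnn -{2}rUy -mxrank_disjoint_sum // mxrankS //.
by rewrite addsmx_sub sUM.
Qed.

End CommutingRepresentations.

(** * Representations of a direct product *)

Section DirectProduct.

Variables (F : numClosedFieldType) (gT1 gT2 : finGroupType).
Variables (G1 : {group gT1}) (G2 : {group gT2}).
Local Notation G := (setX_group G1 G2).

Lemma mulg_pair (x1 y1 : gT1) (x2 y2 : gT2) :
  ((x1, x2) * (y1, y2) = (x1 * y1, x2 * y2))%g.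
Proof. by []. Qed.

Section Factors.

Variables (n : nat) (rG : mx_representation F G n).

Lemma factor1_mx_repr : mx_repr G1 (fun x => rG (x, 1%g)).
Proof.
split=> [|x y G1x G1y]; first exact: repr_mx1.
by rewrite -repr_mxM ?inE /= ?G1x ?G1y ?group1 // mulg_pair mulg1.
Qed.
Definition factor1_repr := MxRepresentation factor1_mx_repr.

Lemma factor2_mx_repr : mx_repr G2 (fun y => rG (1%g, y)).
Proof.
split=> [|x y G2x G2y]; first exact: repr_mx1.
by rewrite -repr_mxM ?inE /= ?G2x ?G2y ?group1 // mulg_pair mulg1.
Qed.
Definition factor2_repr := MxRepresentation factor2_mx_repr.

Lemma factors_mxE x y : x \in G1 -> y \in G2 ->
  rG (x, y) = factor1_repr x *m factor2_repr y.
Proof.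
move=> G1x G2y; rewrite /= -repr_mxM ?inE /= ?G1x ?G2y ?group1 //.
by rewrite mulg_pair mulg1 mul1g.
Qed.

Lemma factors_commute x y : x \in G1 -> y \in G2 ->
  factor1_repr x *m factor2_repr y = factor2_repr y *m factor1_repr x.
Proof.
move=> G1x G2y; rewrite /= -!repr_mxM ?inE /= ?G1x ?G2y ?group1 //.
by rewrite !mulg_pair !mulg1 !mul1g.
Qed.

Lemma mxmodule_factors (U : 'M[F]_n) :
  mxmodule rG U <-> mxmodule factor1_repr U /\ mxmodule factor2_repr U.
Proof.
split=> [modU | [mod1 mod2]].
  by split; apply/mxmoduleP=> x Gx; apply: (mxmoduleP modU);
    rewrite inE /= Gx group1.
apply/mxmoduleP=> -[x y] /setXP[G1x G2y].
rewrite factors_mxE // mulmxA.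
apply: submx_trans (submxMr _ (mxmoduleP mod1 x G1x)) _.
exact: (mxmoduleP mod2).
Qed.

Lemma factor1_faithful : mx_faithful rG -> mx_faithful factor1_repr.
Proof.
move=> /subsetP faithG; apply/subsetP=> x /rkerP[G1x rx1].
have /set1gP[->] : (x, 1%g) \in [1 (gT1 * gT2)]; last exact: set11.
by apply/faithG/rkerP; rewrite inE /= G1x group1.
Qed.

Lemma factor2_faithful : mx_faithful rG -> mx_faithful factor2_repr.
Proof.
move=> /subsetP faithG; apply/subsetP=> y /rkerP[G2y ry1].
have /set1gP[->] : (1%g, y) \in [1 (gT1 * gT2)]; last exact: set11.
by apply/faithG/rkerP; rewrite inE /= G2y group1.
Qed.

End Factors.

(** This is the bound for a single constituent faithful on both factors:
    [M] has dimension at least twice the larger of the two ranks. *)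
Lemma simple_factors_rank n (rG : mx_representation F G n) (M U1 U2 : 'M_n) :
    ~~ abelian G1 -> ~~ abelian G2 -> mxsimple rG M ->
    [/\ mxsimple (factor1_repr rG) U1, (U1 <= M)%MS
      & rstab (factor1_repr rG) U1 = 1%g] ->
    [/\ mxsimple (factor2_repr rG) U2, (U2 <= M)%MS
      & rstab (factor2_repr rG) U2 = 1%g] ->
  (\rank U1 + \rank U2 <= \rank M)%N.
Proof.
move=> nab1 nab2 [modM ntM minM] [simU1 sU1M stU1] [simU2 sU2M stU2].
have [mod1 mod2] := (mxmodule_factors rG M).1 modM.
have cr := @factors_commute n rG.
have cr' y x (Gy : y \in G2) (Gx : x \in G1) := esym (cr x y Gx Gy).
have le1: (2 * \rank U1 <= \rank M)%N.
  apply: (commuting_double_rank cr nab2 mod2 _ simU1 sU1M sU2M stU2).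
  by move=> W modW1 modW2; apply: minM; apply/mxmodule_factors.
have le2: (2 * \rank U2 <= \rank M)%N.
  apply: (commuting_double_rank cr' nab1 mod1 _ simU2 sU2M sU1M stU1).
  by move=> W modW2 modW1; apply: minM; apply/mxmodule_factors.
rewrite -(leq_pmul2l (isT : (0 < 2)%N)) mulnDr (mul2n (\rank M)) -addnn.
by rewrite leq_add.
Qed.

(** Faithfulness on [G1] and on [G2] is each witnessed by one simple summand;
    these either differ, and their ranks add up, or coincide, which is the
    case of [simple_factors_rank]. *)
Lemma faithful_degree_product_ge n N1 N2 :
    monolith N1 G1 -> monolith N2 G2 -> ~~ abelian G1 -> ~~ abelian G2 ->
  faithful_degree F G n -> (delta_irr F G1 + delta_irr F G2 <= n)%N.
Proof.
move=> mono1 mono2 nab1 nab2 [rG faithG].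
set r1 := factor1_repr rG; set r2 := factor2_repr rG.
have [[I W /= simW defW dxW]] := num_mxmodule_semisimple (mxmodule1 rG).
have [i notfix_i] : exists i, ~~ (N1 \subset rstab r1 (W i)).
  have [/normal_sub sNG _ _] := mono1.
  have notfix1 := notsub_rstab_faithful mono1 (factor1_faithful faithG).
  by apply: (exists_not_rstab_sum sNG _ notfix1); rewrite defW.
have [j notfix_j] : exists j, ~~ (N2 \subset rstab r2 (W j)).
  have [/normal_sub sNG _ _] := mono2.
  have notfix1 := notsub_rstab_faithful mono2 (factor2_faithful faithG).
  by apply: (exists_not_rstab_sum sNG _ notfix1); rewrite defW.
have [mod1 _] := (mxmodule_factors rG (W i)).1 (mxsimple_module (simW i)).
have [_ mod2] := (mxmodule_factors rG (W j)).1 (mxsimple_module (simW j)).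
have [U1 [simU1 sU1 stU1]] := exists_faithful_simple mono1 mod1 notfix_i.
have [U2 [simU2 sU2 stU2]] := exists_faithful_simple mono2 mod2 notfix_j.
have le1 := delta_irr_min (simple_faithful_irr_degree simU1 stU1).
have le2 := delta_irr_min (simple_faithful_irr_degree simU2 stU2).
apply: leq_trans (leq_add le1 le2) _.
have [eq_ij | ne_ij] := eqVneq i j.
  rewrite -{j}eq_ij in notfix_j mod2 sU2.
  apply: leq_trans (rank_leq_row (W i)).
  exact: simple_factors_rank nab1 nab2 (simW i) _ _.
apply: leq_trans (leq_add (mxrankS sU1) (mxrankS sU2)) _.
rewrite -[n in (_ <= n)%N](mxrank1 F) -defW (mxdirectP dxW) /=.
rewrite (bigD1 i) //= (bigD1 j) 1?eq_sym //=.
by rewrite addnA leq_addr.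
Qed.

Section DirectSum.

Variables (n1 n2 : nat).
Variables (r1 : mx_representation F G1 n1) (r2 : mx_representation F G2 n2).

Lemma external_sum_mx_repr :
  mx_repr G (fun z => block_mx (r1 z.1) 0 0 (r2 z.2)).
Proof.
split=> [|[x1 y1] [x2 y2] /setXP[G1x1 G2y1] /setXP[G1x2 G2y2]] /=.
  by rewrite !repr_mx1 -scalar_mx_block.
by rewrite mulmx_block !(mulmx0, mul0mx, addr0, add0r) !repr_mxM.
Qed.
Definition external_sum_repr := MxRepresentation external_sum_mx_repr.

Lemma external_sum_faithful :
  mx_faithful r1 -> mx_faithful r2 -> mx_faithful external_sum_repr.
Proof.
move=> faith1 faith2; apply/subsetP=> -[x y] /rkerP[/setXP[G1x G2y]] /=.
rewrite scalar_mx_block => /eq_block_mx[rx _ _ ry].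
have /set1gP-> : x \in [1 gT1] by apply/(subsetP faith1)/rkerP.
have /set1gP-> : y \in [1 gT2] by apply/(subsetP faith2)/rkerP.
exact: set11.
Qed.

End DirectSum.

Lemma delta_product_le :
    has_faithful_irr F G1 -> has_faithful_irr F G2 ->
  (delta F G <= delta_irr F G1 + delta_irr F G2)%N.
Proof.
move=> /delta_irrP[[r1 [faith1 _]] _] /delta_irrP[[r2 [faith2 _]] _].
have [_ min_delta] := deltaP F G; apply: min_delta.
by exists (external_sum_repr r1 r2); apply: external_sum_faithful.
Qed.

Lemma delta_product_monolith N1 N2 :
    monolith N1 G1 -> monolith N2 G2 -> ~~ abelian G1 -> ~~ abelian G2 ->
  [/\ has_faithful_irr F G1, has_faithful_irr F G2
    & delta F G = (delta_irr F G1 + delta_irr F G2)%N].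
Proof.
move=> mono1 mono2 nab1 nab2.
have irr1 := monolith_has_faithful_irr F mono1.
have irr2 := monolith_has_faithful_irr F mono2.
split=> //; apply/eqP; rewrite eqn_leq delta_product_le //=.
have [fdelta _] := deltaP F G.
exact: faithful_degree_product_ge mono1 mono2 nab1 nab2 fdelta.
Qed.

End DirectProduct.

Local Close Scope ring_scope.

Theorem theorem4p1 (R : realType) (gT1 gT2 : finGroupType)
    (G1 : {group gT1}) (G2 : {group gT2}) :
  [\/ [/\ ~~ cyclic G1, simple G1, ~~ cyclic G2 & simple G2],
      (exists p1 p2 : nat,
        [/\ prime p1, prime p2 & p1 <> p2] /\
        [/\ (p1.-group G1)%g, ~~ cyclic G1 & cyclic 'Z(G1)%g] /\
        [/\ (p2.-group G2)%g, ~~ cyclic G2 & cyclic 'Z(G2)%g])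
    | [/\ ~~ abelian G1, monolithic G1, ~~ abelian G2 & monolithic G2] ] ->
  [/\ has_faithful_irr R[i]%C G1,
      has_faithful_irr R[i]%C G2
    & delta R[i]%C (setX_group G1 G2) =
      delta_irr R[i]%C G1 + delta_irr R[i]%C G2].
Proof.
case=> [[ncyc1 sim1 ncyc2 sim2] | | [nab1 mono1 nab2 mono2]].
- have [mono1 mono2] := (simple_monolith sim1, simple_monolith sim2).
  by apply: delta_product_monolith mono1 mono2 _ _;
    apply: simple_noncyclic_nonabelian.
- have ncyc_nt (gT : finGroupType) (G : {group gT}) : ~~ cyclic G -> G :!=: 1%g.
    by apply: contraNneq => ->; apply: cyclic1.
  case=> p1 [p2 [_ [[pG1 ncyc1 cycZ1] [pG2 ncyc2 cycZ2]]]].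
  have mono1 := pgroup_cyclic_center_monolith pG1 (ncyc_nt _ _ ncyc1) cycZ1.
  have mono2 := pgroup_cyclic_center_monolith pG2 (ncyc_nt _ _ ncyc2) cycZ2.
  by apply: delta_product_monolith mono1 mono2 _ _;
    apply: pgroup_cyclic_center_nonabelian.
have [[N1 monoN1] [N2 monoN2]] :=
  (monolithic_monolith mono1, monolithic_monolith mono2).
exact: delta_product_monolith monoN1 monoN2 nab1 nab2.
Qed.
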